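(* Let $G$ be an embedded graph and $n$ a positive integer. Then \[ P(G;n)=\sum_{s}(-1)^{cr(s)}, \] where the sum is over all admissible $n$-valuations $s$ of the medial graph $G_m$ and $cr(s)$ is the number of vertices of $G_m$ at which $s$ is of crossing type.
   Context: An embedded graph is a graph cellularly embedded in a closed (possibly non-orientable) surface. The medial graph $G_m$ has a degree-4 vertex $v_e$ on each edge $e$ of $G$, with edges following face boundaries of $G$ (an isolated vertex contributes a vertex-free closed curve); faces of $G_m$ containing a vertex of $G$ are black, others white. At $v_e$: the white split pairs consecutive half-edges bounding white corners, the black split those bounding black corners, the crossing pairs opposite half-edges. A state chooses a vertex state at each vertex; $c$ = number of resulting closed curves, $cr$ = number of crossings; Penrose states have no black split; $P(G;\lambda)=\sum_{\text{Penrose } t}(-1)^{cr(t)}\lambda^{c(t)}$. An $n$-valuation of $G_m$ is a colouring $\phi:E(G_m)\to\{1,\dots,n\}$ such that at every vertex each colour occurs on an even number of the four incident half-edges. It is admissible if at every vertex either (white-split type) the two half-edges of one white-split pair have colour $i$ and the other pair colour $j$, $i\neq j$, or (crossing type) the two pairs of opposite half-edges have colours $i$ and $j$ respectively, $i\neq j$. *)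

(* Defs.v *)
From HB Require Import structures.
From mathcomp Require Import all_boot all_order all_algebra.

Set Implicit Arguments.
Unset Strict Implicit.
Unset Printing Implicit Defensive.

Import GRing.Theory.
Local Open Scope ring_scope.

(* A graph cellularly embedded in a closed, possibly non-orientable and       *)
(* possibly disconnected, surface, given by its flags.  Each edge carries     *)
(* four flags, one for each choice of an end and a side of the edge:          *)
(*   fl0 x : same edge and side (hence same face), other end;                 *)
(*   fl1 x : same vertex and face, next edge around that corner of the face;  *)
(*   fl2 x : same edge and end, other side.                                   *)
(* Absence of fixed points means that the surface has no boundary.  Edges are *)
(* the orbits of <fl0, fl2>, non-isolated vertices those of <fl1, fl2>, faces *)
(* those of <fl0, fl1>.  A vertex carrying no flag is isolated: it lies alone *)
(* on a sphere component.                                                     *)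
Record embedded_graph := EmbeddedGraph {
  vertex : finType;
  edge : finType;
  flag : finType;
  flag_vertex : flag -> vertex;
  flag_edge : flag -> edge;
  fl0 : flag -> flag;
  fl1 : flag -> flag;
  fl2 : flag -> flag;
  fl0K : involutive fl0;
  fl1K : involutive fl1;
  fl2K : involutive fl2;
  fl0_neq : forall x, fl0 x != x;
  fl1_neq : forall x, fl1 x != x;
  fl2_neq : forall x, fl2 x != x;
  fl02C : forall x, fl0 (fl2 x) = fl2 (fl0 x);
  fl02_neq : forall x, fl0 (fl2 x) != x;
  flag_edge_onto : forall e, exists x, flag_edge x = e;
  flag_edgeP : forall x y, flag_edge x = flag_edge y <->
    y \in [:: x; fl0 x; fl2 x; fl0 (fl2 x)];
  flag_vertexP : forall x y, flag_vertex x = flag_vertex y <->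
    connect [rel a b | (b == fl1 a) || (b == fl2 a)] x y
}.

Section Medial.
Variable G : embedded_graph.

Definition isolated : pred (vertex G) :=
  [pred v | [forall x, flag_vertex x != v]].

(* The vertex v_e of the medial graph is represented by e : edge G.  The four *)
(* half-edges of G_m at v_e are the flags of e; in cyclic order around v_e    *)
(* they are x, fl0 x, fl0 (fl2 x), fl2 x.  The corner between x and fl0 x     *)
(* lies in a face of G (white), the one between x and fl2 x contains an end   *)
(* of e (black).                                                              *)
Definition half_edges (e : edge G) : {set flag G} :=
  [set x | flag_edge x == e].

(* An edge of G_m cuts off the corner {x, fl1 x} of G at a vertex, and its    *)
(* two half-edges are x and fl1 x.                                            *)
Definition corners : {set {set flag G}} := [set [set x; fl1 x] | x : flag G].

(* The second summand accounts for the vertex-free closed curves.             *)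
Definition medial_edge : finType :=
  ({c : {set flag G} | c \in corners} + {v : vertex G | isolated v})%type.

Lemma cornerP (x : flag G) : [set x; fl1 x] \in corners.
Proof. exact: imset_f. Qed.

Definition medial_edge_of (x : flag G) : medial_edge :=
  inl (exist _ [set x; fl1 x] (cornerP x)).

End Medial.

Inductive vertex_state := WhiteSplit | BlackSplit | Crossing.

Definition vertex_state_ord (s : vertex_state) : 'I_3 :=
  match s with WhiteSplit => inord 0 | BlackSplit => inord 1
             | Crossing => inord 2 end.
Definition ord_vertex_state (i : 'I_3) : vertex_state :=
  match val i with 0%N => WhiteSplit | 1%N => BlackSplit | _ => Crossing end.
Lemma vertex_state_ordK : cancel vertex_state_ord ord_vertex_state.
Proof. by case; rewrite /ord_vertex_state /= inordK. Qed.

HB.instance Definition _ := Finite.copy vertex_state (can_type vertex_state_ordK).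

Section Penrose.
Variable G : embedded_graph.

(* The half-edge paired with x at its medial vertex.                          *)
Definition partner (s : vertex_state) (x : flag G) : flag G :=
  match s with
  | WhiteSplit => fl0 x
  | BlackSplit => fl2 x
  | Crossing => fl0 (fl2 x)
  end.

Definition state : finType := {ffun edge G -> vertex_state}.

(* Half-edges are joined along the edges of G_m and through its vertices; the *)
(* vertex-free curves are counted separately.                                 *)
Definition ncurves (t : state) : nat :=
  (n_comp [rel x y | (y == fl1 x) || (y == partner (t (flag_edge x)) x)]
     (flag G) + #|isolated (G := G)|)%N.

Definition ncrossings (t : state) : nat := #|[set e | t e == Crossing]|.

Definition penrose_state (t : state) : bool :=
  [forall e, t e != BlackSplit].

Definition penrose_poly : {poly int} :=
  \sum_(t : state | penrose_state t) (-1) ^+ ncrossings t *: 'X^(ncurves t).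

Variable n : nat.

Definition colouring : finType := {ffun medial_edge G -> 'I_n}.

Definition valuation (phi : colouring) : bool :=
  [forall e, forall i : 'I_n,
    ~~ odd #|[set x in half_edges e | phi (medial_edge_of x) == i]|].

Definition has_type (phi : colouring) (s : vertex_state) (e : edge G) : bool :=
  [exists x in half_edges e, exists i : 'I_n, exists j : 'I_n, (i != j) &&
    [forall y in half_edges e, phi (medial_edge_of y) ==
       (if y \in [set x; partner s x] then i else j)]].

Definition admissible (phi : colouring) : bool :=
  valuation phi &&
  [forall e, has_type phi WhiteSplit e || has_type phi Crossing e].

Definition val_ncrossings (phi : colouring) : nat :=
  #|[set e | has_type phi Crossing e]|.

End Penrose.

(* Main.v *)
Require Import Defs.
From mathcomp Require Import all_boot all_order all_algebra.

(** Call a colouring of the medial edges compatible with a state if it is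
    constant along the curves of the state; there are [n ^ c(t)] such colourings
    of [t].  Expanding [P(G; n)] accordingly and exchanging the two sums, a
    colouring contributes the product over the medial vertices of
    [(compatible with the white split) - (compatible with the crossing)].  This
    factor is [1] at a vertex of white-split type, [-1] at one of crossing type,
    and [0] otherwise. *)

Import GRing.Theory.
Local Open Scope ring_scope.

(** * Signs, products of indicators, parity *)

Lemma sign_card (T : finType) (R : comPzRingType) (P : pred T) :
  (-1) ^+ #|[set x | P x]| = \prod_x (-1) ^+ P x :> R.
Proof.
rewrite -prodr_const big_mkcond /=; apply: eq_bigr => x _.
by rewrite inE; case: (P x).
Qed.

Lemma prodr_if0 (T : finType) (R : comPzRingType) (P : pred T) (F : T -> R) :
  \prod_x (if P x then F x else 0) = if [forall x, P x] then \prod_x F x else 0.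
Proof.
case: ifP => [/forallP hP | /negbT]; first by apply: eq_bigr => x _; rewrite hP.
rewrite negb_forall => /existsP[x /negbTE nPx].
by rewrite (bigD1 x) //= nPx mul0r.
Qed.

(** All orbits of [f] have exactly two elements, and [A] is a union of orbits. *)
Lemma even_card_fpfree_involution (T : finType) (f : T -> T) (A : {pred T}) :
    involutive f -> (forall x, f x != x) -> (forall x, (f x \in A) = (x \in A)) ->
  ~~ odd #|A|.
Proof.
move=> fK f_neq fA.
have order2 x : order f x = 2%N.
  have /card_uniqP card2 : uniq [:: x; f x] by rewrite /= inE eq_sym f_neq.
  rewrite -[RHS]card2.
  have cyc : fcycle f [:: x; f x] by rewrite /= !eqxx fK eqxx.
  apply: eq_card => y; rewrite inE.
  by rewrite (fconnect_cycle cyc) // inE eqxx.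
rewrite -(@fcard_order_set _ f (can_inj fK) 2 A) ?muln2 ?odd_double //.
  by apply/subsetP => x _; rewrite inE order2.
by move=> x y /eqP <-; rewrite fA.
Qed.

(** * Local analysis at a medial vertex *)

Section Valuations.
Variables (G : embedded_graph) (n : nat).
Implicit Types (s : vertex_state) (e : edge G) (x y : flag G).
Implicit Types (t : state G) (phi : colouring G n).

Lemma partnerK s : involutive (@partner G s).
Proof.
by case: s => x /=; rewrite ?fl0K ?fl2K // fl02C fl0K fl2K.
Qed.

Lemma partner_neq s x : partner s x != x.
Proof. by case: s => /=; rewrite ?fl0_neq ?fl2_neq ?fl02_neq. Qed.

Lemma partner_edge s x : flag_edge (partner s x) = flag_edge x.
Proof. by apply/esym/flag_edgeP; case: s => /=; rewrite !inE eqxx ?orbT. Qed.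

Lemma partner_neq_state s s' x : s <> s' -> partner s x != partner s' x.
Proof.
(* Equality would make [fl2 y] a fixed point of [fl0] after [fl2]. *)
have n02 y : fl0 y != fl2 y.
  by apply/eqP => h; have := fl02_neq (fl2 y); rewrite fl2K h eqxx.
have n0c y : fl0 y != fl0 (fl2 y).
  by rewrite (inj_eq (can_inj (@fl0K G))) eq_sym fl2_neq.
by case: s s' => [] [] //= _; rewrite ?n02 ?n0c ?fl0_neq // eq_sym ?n02 ?n0c ?fl0_neq.
Qed.

(** The three pairings and the identity form a Klein four-group that is transitive on the half-edges
    at a medial vertex; any two distinct pairings generate it. *)
Lemma edge_partners s s' x y : s <> s' -> flag_edge x = flag_edge y ->
  y \in [:: x; partner s x; partner s' x; partner s (partner s' x)].
Proof.
move=> ns /flag_edgeP; rewrite !inE.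
by case: s s' ns => [] [] //= _;
  rewrite ?fl02C ?fl0K ?fl2K -?fl02C ?fl0K ?fl2K => /or4P[] ->; rewrite ?orbT.
Qed.

Definition compatible_at phi s e : bool :=
  [forall x in half_edges e,
     phi (medial_edge_of (partner s x)) == phi (medial_edge_of x)].

Lemma compatible_atP phi s e :
  reflect (forall x, flag_edge x = e ->
             phi (medial_edge_of (partner s x)) = phi (medial_edge_of x))
          (compatible_at phi s e).
Proof.
apply: (iffP forall_inP) => h x.
  by move=> ex; apply/eqP/h; rewrite inE ex.
by rewrite inE => /eqP ex; rewrite h.
Qed.

(** The pairing of [s'] swaps the two pairs of [s]. Hence, once each pair of [s] is monochromatic,
    compatibility with [s'] means that the two colours coincide. *)
Lemma has_typeE phi s s' e : s <> s' ->
  has_type phi s e = compatible_at phi s e && ~~ compatible_at phi s' e.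
Proof.
move=> ns; have ns' : s' <> s by move/esym.
apply/idP/idP.
  case/existsP => x /andP[]; rewrite inE => /eqP ex /existsP[i /existsP[j]].
  case/andP=> nij /forall_inP col.
  have {}col y : flag_edge y = e ->
      phi (medial_edge_of y) = if y \in [set x; partner s x] then i else j.
    by move=> ey; apply/eqP/col; rewrite inE ey.
  apply/andP; split.
    apply/compatible_atP => y ey; rewrite !col ?partner_edge // !inE.
    by rewrite (can2_eq (partnerK s) (partnerK s)) (inj_eq (can_inj (partnerK s))) orbC.
  (* [x] has colour [i], while [partner s' x] lies in the other pair and has colour [j]. *)
  apply/negP => /compatible_atP/(_ _ ex); rewrite !col ?partner_edge // !inE eqxx /=.
  rewrite (negbTE (partner_neq _ _)) (negbTE (partner_neq_state _ _ _ ns')) /=.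
  by move=> /esym ij; rewrite ij eqxx in nij.
(* A half-edge [x] violating compatibility with [s'] supplies both colours: its own and that of
   [partner s' x]. *)
case/andP => /compatible_atP hs /forall_inPn[x]; rewrite inE => /eqP ex nq.
apply/existsP; exists x; rewrite inE ex eqxx /=.
apply/existsP; exists (phi (medial_edge_of x)).
apply/existsP; exists (phi (medial_edge_of (partner s' x))).
rewrite eq_sym nq /=; apply/forall_inP => y; rewrite inE => /eqP ey.
have ep : flag_edge (partner s' x) = e by rewrite partner_edge.
have exy : flag_edge x = flag_edge y by rewrite ex.
have := edge_partners s s' x y ns exy.
rewrite !inE => /or4P[]/eqP ->; rewrite ?eqxx ?orbT ?hs //=.
  by rewrite (negbTE (partner_neq _ _)) (negbTE (partner_neq_state _ _ _ ns')).
rewrite (can2_eq (partnerK s) (partnerK s)) (inj_eq (can_inj (partnerK s))).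
by rewrite (negbTE (partner_neq _ _)) (negbTE (partner_neq_state _ _ _ ns')).
Qed.

Lemma compatible_at_even phi s e (i : 'I_n) : compatible_at phi s e ->
  ~~ odd #|[set x in half_edges e | phi (medial_edge_of x) == i]|.
Proof.
move/compatible_atP => hs.
apply: (@even_card_fpfree_involution _ (partner s)) => [|x|x].
- exact: partnerK.
- exact: partner_neq.
- by rewrite !inE partner_edge; case: eqP => //= ex; rewrite hs.
Qed.

(** Either type makes [phi] compatible with a vertex state, whose pairing preserves each colour
    class; parity follows from [compatible_at_even]. *)
Lemma admissibleE phi : admissible phi =
  [forall e, has_type phi WhiteSplit e || has_type phi Crossing e].
Proof.
rewrite /admissible andb_idl // => /forallP h.
apply/forallP => e; apply/forallP => i.
case/orP: (h e);
  [rewrite (@has_typeE _ _ Crossing) | rewrite (@has_typeE _ _ WhiteSplit)];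
  by [ | case/andP => hc _; exact: compatible_at_even hc].
Qed.

(** * Colourings constant along the curves of a state *)

Section Curves.
Variable t : state G.

Definition curve_rel : rel (flag G) :=
  [rel x y | (y == fl1 x) || (y == partner (t (flag_edge x)) x)].

Lemma curve_rel_sym : symmetric curve_rel.
Proof.
suff sub x y : curve_rel x y -> curve_rel y x by move=> x y; apply/idP/idP => /sub.
case/orP => /eqP ->; rewrite /curve_rel /=; first by rewrite fl1K eqxx.
by rewrite partner_edge partnerK eqxx orbT.
Qed.

Lemma curve_connect_sym : connect_sym curve_rel.
Proof. exact: sym_connect_sym curve_rel_sym. Qed.

(** A curve through medial vertices is a connected component of half-edges, represented by its root;
    a vertex-free curve is represented by its isolated vertex. *)
Definition curve : finType :=
  ({x : flag G | roots curve_rel x} + {v : vertex G | isolated v})%type.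

Lemma card_curve : #|curve| = ncurves t.
Proof.
rewrite card_sum !card_sig /ncurves; congr addn.
by apply: eq_card => x; rewrite !inE andbT.
Qed.

Lemma root_curve x : roots curve_rel (fingraph.root curve_rel x).
Proof. exact: roots_root curve_connect_sym x. Qed.

Lemma corner_ex (c : {c : {set flag G} | c \in corners G}) :
  exists x, sval c == [set x; fl1 x].
Proof. by case: c => c /= /imsetP[x _ ->]; exists x. Qed.

(** A medial edge is an unordered corner, so one of its half-edges has to be chosen; by
    [root_corner] the resulting root does not depend on the choice. *)
Definition curve_of (m : medial_edge G) : curve :=
  match m with
  | inl c => inl (exist (fun x => roots curve_rel x) _
                    (root_curve (xchoose (corner_ex c))))
  | inr v => inr v
  end.

Definition edge_on_curve (k : curve) : medial_edge G :=
  match k with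
  | inl x => medial_edge_of (sval x)
  | inr v => inr v
  end.

Lemma root_corner x :
  fingraph.root curve_rel
    (xchoose (corner_ex (exist _ [set x; fl1 x] (cornerP x)))) =
  fingraph.root curve_rel x.
Proof.
set y := xchoose _.
have /eqP /= hy := xchooseP (corner_ex (exist _ [set x; fl1 x] (cornerP x))).
rewrite -/y in hy; apply/eqP.
rewrite root_connect; last exact: curve_connect_sym.
rewrite curve_connect_sym.
have : y \in [set x; fl1 x] by rewrite hy !inE eqxx.
rewrite !inE => /orP[]/eqP ->; first exact: connect0.
by apply: connect1; rewrite /curve_rel /= eqxx.
Qed.

Lemma edge_on_curveK : cancel edge_on_curve curve_of.
Proof.
case=> [[x rx] | v] //=; congr inl; apply: val_inj => /=.
by rewrite root_corner (eqP rx).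
Qed.

Definition compatible phi : bool := [forall e, compatible_at phi (t e) e].

Lemma compatible_connect phi x y : compatible phi -> connect curve_rel x y ->
  phi (medial_edge_of x) = phi (medial_edge_of y).
Proof.
move=> /forallP cphi /connectP[p].
elim: p x => [|z p IH] x /=; first by move=> _ ->.
case/andP => /orP[]/eqP -> pp /(IH _ pp) <-.
  (* A step along [fl1] stays on the same medial edge. *)
  congr (phi (inl _)); apply: val_inj => /=.
  by rewrite fl1K setUC.
by have /compatible_atP -> := cphi (flag_edge x).
Qed.

(** The two medial edges may differ, but they lie on the same curve of [t]. *)
Lemma compatible_curve phi m : compatible phi ->
  phi (edge_on_curve (curve_of m)) = phi m.
Proof.
move=> cphi; case: m => [c | v] //=.
set y := xchoose _; have /eqP hy := xchooseP (corner_ex c); rewrite -/y in hy.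
have -> : inl c = medial_edge_of y by congr inl; apply: val_inj.
apply: (@compatible_connect phi _ y cphi).
by rewrite curve_connect_sym connect_root.
Qed.

(** Pulling back along [curve_of] is a bijection from colourings of the curves to compatible
    colourings. It is injective because [edge_on_curve] is a section of [curve_of]. *)
Lemma card_compatible : #|[set phi | compatible phi]| = (n ^ ncurves t)%N.
Proof.
pose F (g : {ffun curve -> 'I_n}) : colouring G n := [ffun m => g (curve_of m)].
have F_inj : injective F.
  move=> g h /ffunP Fgh; apply/ffunP => k.
  by have := Fgh (edge_on_curve k); rewrite !ffunE edge_on_curveK.
rewrite -card_curve -[n in RHS]card_ord -card_ffun -(card_imset _ F_inj).
apply: eq_card => phi; rewrite inE; apply/idP/imsetP => [cphi | [g _ ->]].
  exists [ffun k => phi (edge_on_curve k)] => //.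
  by apply/ffunP => m; rewrite !ffunE compatible_curve.
apply/forallP => e; apply/compatible_atP => x ex; rewrite !ffunE; congr (g _).
congr inl; apply: val_inj; rewrite /= !root_corner; apply/eqP.
rewrite root_connect; last exact: curve_connect_sym.
by rewrite curve_connect_sym connect1 // /curve_rel /= ex eqxx orbT.
Qed.

End Curves.

(** * Exchange of the sums over states and colourings *)

Lemma compatible_sum phi :
  \sum_(t : state G | penrose_state t && compatible t phi) (-1) ^+ ncrossings t =
  (if admissible phi then (-1) ^+ val_ncrossings phi else 0) :> int.
Proof.
pose F e s : int := if (s != BlackSplit) && compatible_at phi s e
  then (-1) ^+ (s == Crossing) else 0.
(* Distributivity turns a sum over states into a product of local sums; [F] vanishes on forbidden
   choices, so only compatible Penrose states survive. *)
transitivity (\prod_e \sum_s F e s).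
  rewrite bigA_distr_bigA big_mkcond /=; apply: eq_bigr => t _.
  rewrite prodr_if0 /ncrossings sign_card; congr (if _ then _ else _).
  apply/andP/forallP => [[/forallP p /forallP c] e | h]; first by rewrite p c.
  by split; apply/forallP => e; case/andP: (h e).
rewrite admissibleE /val_ncrossings sign_card -prodr_if0; apply: eq_bigr => e _.
have nCW : Crossing != WhiteSplit by apply/eqP.
have nWC : WhiteSplit != Crossing by apply/eqP.
have nWB : WhiteSplit != BlackSplit by apply/eqP.
have nCB : Crossing != BlackSplit by apply/eqP.
rewrite (bigD1 WhiteSplit) //= (bigD1 Crossing) ?nCW //= big1 ?addr0; last first.
  by case; rewrite ?eqxx ?andbF // /F eqxx.
rewrite /F nWB nCB (negbTE nWC) eqxx.
rewrite (@has_typeE _ WhiteSplit Crossing) // (@has_typeE _ Crossing WhiteSplit) //=.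
(* If both compatibilities hold, the terms 1 and -1 cancel; if neither holds, both are 0. *)
by case: (compatible_at _ _ _); case: (compatible_at _ _ _).
Qed.

End Valuations.

Theorem theorem6p8 (G : embedded_graph) (n : nat) (hn : (0 < n)%N) :
  (penrose_poly G).[n%:R] =
  \sum_(s : colouring G n | admissible s) (-1) ^+ val_ncrossings s.
Proof.
rewrite /penrose_poly horner_sum.
transitivity (\sum_(t : state G | penrose_state t)
  \sum_(phi : colouring G n | compatible _ _ t phi) (-1) ^+ ncrossings t : int).
  (* The power of [n] is read as the number of colourings compatible with [t]. *)
  apply: eq_bigr => t _; rewrite hornerZ hornerXn -natrX -card_compatible.
  by rewrite mulr_natr -sumr_const; apply: eq_bigl => phi; rewrite inE.
rewrite (exchange_big_dep predT) //= [RHS]big_mkcond /=.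
by apply: eq_bigr => phi _; exact: compatible_sum.
Qed.
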